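(* No polynomial hypergroup $K_{\mathbf P}$ is an almost-strong Ramsey hypergroup.
   Context: Let $\mathbf P=(P_n)_{n\in\mathbb{Z}_+}$ be an orthogonal polynomial system ($\deg P_n=n$), normalized so that the linearization coefficients $g(n,m;k)$ in $P_nP_m=\sum_{k=|n-m|}^{n+m}g(n,m;k)P_k$ sum to $1$, and such that $g(n,m;k)\ge 0$ for all $n,m$ and $|n-m|\le k\le n+m$. The polynomial hypergroup $K_{\mathbf P}$ is $\mathbb{Z}_+$ with convolution $\delta_n*\delta_m=\sum_{k=|n-m|}^{n+m}g(n,m;k)\delta_k$ (extended bilinearly), identity $0$ and identity involution; it is a hermitian discrete hypergroup. A subhypergroup of a discrete hypergroup $K$ (identity $e$, involution $\vee$) is a subset $L\ni e$ with $\check L=L$ and $\operatorname{spt}(\delta_x*\delta_y)\subset L$ for all $x,y\in L$. An infinite discrete hypergroup $K$ is an almost-strong Ramsey hypergroup if for every finite partition $K=\bigcup_{i=1}^rC_i$ there exist $i$, an infinite subhypergroup $L$ of $K$ and a finite subset $D\subset L$ such that $L\setminus D\subset C_i$. *)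

(* Defs.v *)
From HB Require Import structures.
From mathcomp Require Import all_boot all_order all_algebra.
From mathcomp Require Import all_classical all_reals all_analysis.
From mathcomp Require Import zify.

Set Implicit Arguments.
Unset Strict Implicit.
Unset Printing Implicit Defensive.

Import Order.TTheory GRing.Theory Num.Theory.
Import numFieldNormedType.Exports.

Local Open Scope classical_set_scope.
Local Open Scope ring_scope.

(* The measure delta_x * delta_y is given by its density [hconv x y] with
   respect to counting measure: it is a probability measure whose support is
   compact, i.e. finite.  The bilinear extension of * is the usual one, whence
   the form of associativity below.  Continuity axioms are void for discrete
   hypergroups. *)
Record discreteHypergroup (R : realType) := DiscreteHypergroup {
  hcarrier :> choiceType;
  hconv : hcarrier -> hcarrier -> hcarrier -> R;
  hunit : hcarrier;
  hinv : hcarrier -> hcarrier;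
  hconv_finite : forall x y, finite_set [set z | hconv x y z != 0];
  hconv_ge0 : forall x y z, 0 <= hconv x y z;
  hconv_sum1 : forall x y, \sum_(z \in [set: hcarrier]) hconv x y z = 1;
  hconvA : forall x y z w,
    \sum_(u \in [set: hcarrier]) hconv x y u * hconv u z w =
    \sum_(u \in [set: hcarrier]) hconv y z u * hconv x u w;
  hconv1x : forall x y, hconv hunit x y = (y == x)%:R;
  hconvx1 : forall x y, hconv x hunit y = (y == x)%:R;
  hinvK : involutive hinv;
  hconv_inv : forall x y z, hconv x y (hinv z) = hconv (hinv y) (hinv x) z;
  hconv_unit : forall x y, hconv x y hunit != 0 <-> x = hinv y
}.

Definition hspt (R : realType) (K : discreteHypergroup R) (x y : K) : set K :=
  [set z | hconv x y z != 0].

Definition subhypergroup (R : realType) (K : discreteHypergroup R)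
    (L : set K) : Prop :=
  [/\ L (hunit K), @hinv R K @` L = L
    & forall x y, L x -> L y -> hspt x y `<=` L].

Definition almost_strong_Ramsey (R : realType) (K : discreteHypergroup R) :
    Prop :=
  infinite_set [set: K] /\
  forall (r : nat) (C : 'I_r -> set K), partition setT C [set: K] ->
    exists (i : 'I_r) (L D : set K),
      [/\ subhypergroup L, infinite_set L, finite_set D, D `<=` L
        & L `\` D `<=` C i].

(* Positivity of the last integrals says that no P n vanishes in L^2(mu), i.e.
   that mu does not have finite support. *)
Definition orthogonal_poly_system (R : realType) (P : nat -> {poly R}) : Prop :=
  (forall n, size (P n) = n.+1) /\
  exists mu : {measure set (measurableTypeR R) -> \bar R},
    [/\ forall p : {poly R}, mu.-integrable setT (fun x => (p.[x])%:E),
        forall n m, n != m -> (\int[mu]_x ((P n).[x] * (P m).[x])%:E = 0)%E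
      & forall n, (0 < \int[mu]_x ((P n).[x] ^+ 2)%:E)%E].

(* [lincoef n m k] is only meaningful for |n - m| <= k <= n + m; there it is
   determined by [opoly], whose members are linearly independent. *)
Record polyHypergroupSystem (R : realType) := PolyHypergroupSystem {
  opoly : nat -> {poly R};
  lincoef : nat -> nat -> nat -> R;
  opoly_orthogonal : orthogonal_poly_system opoly;
  lincoefE : forall n m : nat, opoly n * opoly m =
    \sum_(`|n - m|%N <= k < (n + m).+1) lincoef n m k *: opoly k;
  lincoef_sum1 : forall n m : nat,
    \sum_(`|n - m|%N <= k < (n + m).+1) lincoef n m k = 1;
  lincoef_ge0 : forall n m k : nat,
    (`|n - m| <= k <= n + m)%N -> 0 <= lincoef n m k
}.

Definition poly_conv (R : realType) (S : polyHypergroupSystem R)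
    (n m k : nat) : R :=
  if (`|n - m| <= k <= n + m)%N then lincoef S n m k else 0.

Section PolyHypergroup.
Variables (R : realType) (S : polyHypergroupSystem R).
Local Notation P := (opoly S).
Local Notation g := (@lincoef R S).
Local Notation c := (@poly_conv R S).

Let size_P n : size (P n) = n.+1.
Proof. by have [] := opoly_orthogonal S. Qed.

Lemma poly_conv_out n m k : (n + m < k)%N -> c n m k = 0.
Proof. by move=> h; rewrite /poly_conv ifF//; apply/negbTE; lia. Qed.

Lemma poly_conv_finite n m : finite_set [set k | c n m k != 0].
Proof.
apply: (@sub_finite_set _ _ `I_(n + m).+1) => [k /=|]; last exact: finite_II.
by apply: contraNT; rewrite -leqNgt => h; rewrite poly_conv_out.
Qed.

Lemma poly_conv_ge0 n m k : 0 <= c n m k.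
Proof. by rewrite /poly_conv; case: ifP => // h; exact: lincoef_ge0. Qed.

Let fsum_ord N (F : nat -> R) : (forall k, (N <= k)%N -> F k = 0) ->
  \sum_(k \in [set: nat]) F k = \sum_(k < N) F k.
Proof.
move=> h; rewrite (fsbig_ord _ N F); symmetry; apply: fsbig_widen => //= k [_ /= /negP].
by rewrite -leqNgt; exact: h.
Qed.

Let conv_sum (V : lmodType R) N n m (F : nat -> V) : (n + m < N)%N ->
  \sum_(k < N) c n m k *: F k =
  \sum_(`|n - m|%N <= k < (n + m).+1) g n m k *: F k.
Proof.
move=> h; rewrite -(big_mkord xpredT (fun k => c n m k *: F k)).
rewrite (@big_cat_nat _ _ _ `|n - m|%N)/=; [|lia..].
rewrite big_nat big1 ?add0r; last first.
  by move=> k hk; rewrite /poly_conv ifF ?scale0r//; apply/negbTE; lia.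
rewrite (@big_cat_nat _ _ _ (n + m).+1)/=; [|lia..].
rewrite [X in _ + X]big_nat [X in _ + X]big1 ?addr0; last first.
  by move=> k hk; rewrite poly_conv_out ?scale0r//; lia.
by apply: eq_big_nat => k hk; rewrite /poly_conv ifT//; lia.
Qed.

Lemma poly_conv_sum1 n m : \sum_(k \in [set: nat]) c n m k = 1.
Proof.
rewrite (@fsum_ord (n + m).+1); last by move=> k; exact: poly_conv_out.
have := @conv_sum R^o (n + m).+1 n m (fun=> 1) (leqnn _).
under eq_bigr do rewrite [_ *: _]mulr1.
under [in RHS]eq_bigr do rewrite [_ *: _]mulr1.
by rewrite lincoef_sum1.
Qed.

Lemma poly_convE N n m : (n + m < N)%N ->
  P n * P m = \sum_(k < N) c n m k *: P k.
Proof. by move=> h; rewrite conv_sum// lincoefE. Qed.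

Lemma opoly_free N (a : nat -> R) : \sum_(k < N) a k *: P k = 0 ->
  forall k, (k < N)%N -> a k = 0.
Proof.
elim: N => // N IH; rewrite big_ord_recr/= => h.
have aN : a N = 0.
  have /(congr1 (fun p : {poly R} => p`_N)) := h.
  rewrite coefD coefZ coef0 coef_sum big1 ?add0r.
    move/eqP; rewrite mulf_eq0 => /orP[/eqP//|].
    have := lead_coef_eq0 (P N); rewrite lead_coefE size_P /= => ->.
    by rewrite -size_poly_eq0 size_P.
  move=> k _; rewrite coefZ nth_default ?mulr0// size_P; exact: ltn_ord.
move=> k; rewrite ltnS leq_eqVlt => /orP[/eqP->//|]; apply: IH.
by move: h; rewrite aN scale0r addr0.
Qed.

Lemma opoly_inj N (a b : nat -> R) :
  \sum_(k < N) a k *: P k = \sum_(k < N) b k *: P k ->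
  forall k, (k < N)%N -> a k = b k.
Proof.
move=> h k kN; apply/eqP; rewrite -subr_eq0; apply/eqP.
apply: (@opoly_free N (fun k => a k - b k)) => //.
under eq_bigr do rewrite scalerBl.
by rewrite sumrB h subrr.
Qed.

Lemma poly_convA n m l w :
  \sum_(u \in [set: nat]) c n m u * c u l w =
  \sum_(u \in [set: nat]) c m l u * c n u w.
Proof.
pose N := (n + m + l + w).+1.
rewrite (@fsum_ord N); last first.
  by move=> k hk; rewrite (@poly_conv_out n m k) ?mul0r//; move: hk; rewrite /N; lia.
rewrite (@fsum_ord N); last first.
  by move=> k hk; rewrite (@poly_conv_out m l k) ?mul0r//; move: hk; rewrite /N; lia.
pose M := (N + N)%N.
apply: (@opoly_inj M (fun w => \sum_(u < N) c n m u * c u l w)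
   (fun w => \sum_(u < N) c m l u * c n u w)); last by rewrite /M /N; lia.
transitivity (P n * P m * P l).
  rewrite (@poly_convE N n m) ?mulr_suml; last by rewrite /N; lia.
  under eq_bigr do rewrite scaler_suml.
  rewrite exchange_big; apply: eq_bigr => u _ /=.
  rewrite -scalerAl (@poly_convE M u l); last first.
    by have := ltn_ord u; rewrite /M /N; lia.
  by rewrite scaler_sumr; apply: eq_bigr => k _; rewrite scalerA.
rewrite -mulrA (@poly_convE N m l) ?mulr_sumr; last by rewrite /N; lia.
under [in RHS]eq_bigr do rewrite scaler_suml.
rewrite [in RHS]exchange_big; apply: eq_bigr => u _ /=.
rewrite -scalerAr (@poly_convE M n u); last first.
  by have := ltn_ord u; rewrite /M /N; lia.
by rewrite scaler_sumr; apply: eq_bigr => k _; rewrite scalerA.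
Qed.

Lemma poly_conv0n n k : c 0 n k = (k == n)%:R.
Proof.
rewrite /poly_conv; case: eqVneq => [->|kn]; last by rewrite ifF//; lia.
rewrite ifT; last by lia.
have := lincoef_sum1 S 0 n.
rewrite (_ : `|0%N - n|%N = n) ?add0n; last by lia.
by rewrite big_nat1.
Qed.

Lemma poly_convn0 n k : c n 0 k = (k == n)%:R.
Proof.
rewrite /poly_conv; case: eqVneq => [->|kn]; last by rewrite ifF//; lia.
rewrite ifT; last by lia.
have := lincoef_sum1 S n 0.
rewrite (_ : `|n - 0%N|%N = n) ?addn0; last by lia.
by rewrite big_nat1.
Qed.

Lemma opoly0 : P 0 = 1.
Proof.
have := @poly_convE 1 0 0 (leqnn 1); rewrite big_ord1 poly_conv0n scale1r.
rewrite -[X in _ = X]mulr1; apply: mulfI.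
by rewrite -size_poly_eq0 size_P.
Qed.

Lemma poly_convC n m k : c n m k = c m n k.
Proof.
have [h|h] := ltnP (n + m) k; first by rewrite !poly_conv_out// addnC.
apply: (@opoly_inj (n + m).+1 (c n m) (c m n)) => //.
rewrite -(@poly_convE _ n m)// -(@poly_convE _ m n) ?[(m + n)%N]addnC//.
exact: mulrC.
Qed.

Lemma poly_conv_unit n m : c n m 0%N != 0 <-> n = m.
Proof.
split=> [|<-]; first by rewrite /poly_conv; case: ifP => [h _|]; [lia|rewrite eqxx].
apply/eqP => c0.
have [_ [mu [mui mu0 mupos]]] := opoly_orthogonal S.
have := mupos n; rewrite lt_def => /andP[/eqP + _]; apply.
transitivity (\int[mu]_x
    (\sum_(k < (n + n).+1) (c n n k)%:E * ((P k).[x] * (P 0).[x])%:E)%E)%E.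
  apply: eq_integral => x _.
  rewrite expr2 -hornerM (poly_convE (leqnn _)) horner_sum -sumEFin.
  by apply: eq_bigr => k _; rewrite opoly0 hornerZ hornerC mulr1 EFinM.
have muP k : mu.-integrable setT (fun x => ((P k).[x] * (P 0).[x])%:E).
  by have := mui (P k * P 0); congr integrable; apply/funext => x; rewrite hornerM.
rewrite integral_sum//; last first.
  by move=> k; apply: integrableZl => //; exact: muP.
rewrite big1// => k _; rewrite integralZl//.
have [k0|k0] := eqVneq (k : nat) 0%N; first by rewrite k0 c0 mul0e.
by rewrite mu0// mule0.
Qed.

Definition polyHypergroup : discreteHypergroup R :=
  @DiscreteHypergroup R nat c 0%N id poly_conv_finite poly_conv_ge0
    poly_conv_sum1 poly_convA poly_conv0n poly_convn0 (fun=> erefl)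
    poly_convC poly_conv_unit.

End PolyHypergroup.

(* Main.v *)
Require Import Defs.
From mathcomp Require Import all_boot all_order all_algebra.
From mathcomp Require Import all_classical all_reals all_analysis.

(** If [n] lies in a subhypergroup then so does [2n], because [P_n ^+ 2] has
    degree [2n].  Colour [n] by the parity of the integer part of [log_2 n]:
    then [n] and [2n] always have different colours, whereas an infinite
    subhypergroup minus a finite set contains some [n > 0] along with [2n]. *)

Import GRing.Theory.

Local Open Scope classical_set_scope.
Local Open Scope ring_scope.

(** If this top coefficient vanished, the expansion of [P_n * P_m] would only have terms of degree
    below [n + m]. *)
Lemma poly_conv_add_neq0 (R : realType) (S : polyHypergroupSystem R) n m :
  poly_conv S n m (n + m) != 0.
Proof.
have [sizeP _] := opoly_orthogonal S.
have Pneq0 k : opoly S k != 0 by rewrite -size_poly_gt0 sizeP.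
apply/eqP => c0.
have : (size (opoly S n * opoly S m)%R <= n + m)%N.
  rewrite (poly_convE S (leqnn _)) big_ord_recr/= c0 scale0r addr0.
  apply: leq_trans (size_sum _ _ _) _; apply/bigmax_leqP => k _.
  by rewrite (leq_trans (size_scale_leq _ _))// sizeP.
by rewrite size_mul// !sizeP addSn addnS /= ltnn.
Qed.

(** By convention [trunc_log 2 0 = 0], so 0 gets colour 0. *)
Definition log2_parity (i : 'I_2) : set nat :=
  [set n | odd (trunc_log 2 n) = i :> nat].

Lemma log2_parity_partition : partition setT log2_parity [set: nat].
Proof.
split.
- apply/seteqP; split => // n _.
  by exists (inord (odd (trunc_log 2 n))) => //=;
    rewrite /log2_parity/= inordK//; case: odd.
- by move=> i j _ _ [n [/= ni nj]]; apply/val_inj; rewrite /= -ni nj.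
(* The logarithms of 1 and 2 are 0 and 1. *)
- by case=> [[|[|//]]] h _; [exists 1%N | exists 2%N].
Qed.

Lemma log2_parity_double i n : (0 < n)%N ->
  log2_parity i n -> ~ log2_parity i n.*2.
Proof.
by rewrite /log2_parity/= => n0 <-; rewrite trunc_log2_double//=; case: odd.
Qed.

Theorem theorem3p12 (R : realType) (S : polyHypergroupSystem R) :
  ~ almost_strong_Ramsey (polyHypergroup S).
Proof.
move=> [_ /(_ _ _ log2_parity_partition)[i [L [D [[_ _ Lconv] Linf Dfin _ LD]]]]].
(* Avoid 0, which is its own double, then [D], and the halves of [D] so that [n.*2] also lies
   outside [D]. *)
have Efin : finite_set ([set 0%N] `|` (D `|` half @` D) : set nat).
  by rewrite !finite_setU; do !split => //; exact: finite_image.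
have [n [Ln /= nE]] := infinite_setN0 (infinite_setD Linf Efin).
have n0 : (0 < n)%N by rewrite lt0n; apply/eqP => n0; apply: nE; left.
apply: (@log2_parity_double i n) => //; apply: LD; split.
- by [].
- by move=> Dn; apply: nE; right; left.
- apply: (Lconv _ _ Ln Ln).
  by rewrite /hspt/= -addnn; exact: poly_conv_add_neq0.
- by move=> D2n; apply: nE; right; right; exists n.*2 => //; exact: doubleK.
Qed.
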